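(* Let $(x,y,k)$ be a primitive solution of $y^2=x^3+k$ for which $y/x$ is a convergent $p_n/q_n$ of $\sqrt x$, let $a=a_{n+1}$ be the next partial quotient, and put $u=(y+x^{3/2})/x$. Then $$\frac{u}{a+2}<|k|<\frac ua.$$
   Context: A solution is a triple $(x,y,k)$ of integers with $y^2=x^3+k$, $x\ge 1$, $y\ge 1$ and $k\ne 0$. It is primitive when $\gcd(x,y)=1$. Here $\sqrt x=[a_0;a_1,a_2,\ldots]$ is the simple (regular) continued fraction expansion, with partial quotients $a_i$, and $p_n/q_n=[a_0;a_1,\ldots,a_n]$ are its convergents, written in lowest terms with $q_n\ge1$. *)

(* Defs.v *)
From HB Require Import structures.
From mathcomp Require Import all_boot all_order all_algebra.
From mathcomp Require Import all_classical all_reals all_analysis.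
Set Implicit Arguments.
Unset Strict Implicit.
Unset Printing Implicit Defensive.
Import Order.TTheory GRing.Theory Num.Theory.
Local Open Scope ring_scope.

Definition solution (x y k : int) : Prop :=
  [/\ y ^+ 2 = x ^+ 3 + k, 1 <= x, 1 <= y & k != 0].

Definition primitive_solution (x y k : int) : Prop :=
  solution x y k /\ gcdz x y = 1.

(* The expansion of a rational number terminates: complete and partial
   quotients are None from the first index past its last term. *)
Fixpoint complete_quotient (R : realType) (alpha : R) (n : nat) : option R :=
  if n is m.+1 then
    if complete_quotient alpha m is Some t then
      let f := t - (Num.floor t)%:~R in
      if f == 0 then None else Some f^-1
    else None
  else Some alpha.

Definition partial_quotient (R : realType) (alpha : R) (n : nat) : option int :=
  omap Num.floor (complete_quotient alpha n).

(* [a_0; a_1, ..., a_n] as a rational number. Since 0^-1 = 0, the last term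
   contributes a_n + 0^-1 = a_n. *)
Definition cf_value (s : seq int) : rat :=
  foldr (fun a r => a%:~R + r^-1) 0 s.

(* The convergent p_n/q_n, whose lowest terms are p_n = numq and q_n = denq of
   the value; it exists only when a_n does, and then pmap discards nothing. *)
Definition convergent (R : realType) (alpha : R) (n : nat) : option rat :=
  if partial_quotient alpha n is Some _ then
    Some (cf_value (pmap (partial_quotient alpha) (iota 0 n.+1)))
  else None.

(* Main.v *)
Require Import Defs.
From HB Require Import structures.
From mathcomp Require Import all_boot all_order all_algebra.
From mathcomp Require Import all_classical all_reals all_analysis.
From mathcomp Require Import ring lra zify.
Import Order.TTheory GRing.Theory Num.Theory.
Local Open Scope ring_scope.

(** Let [f] be the fractional part of the [n]-th complete quotient of [alpha]
    and [a = floor (1 / f)].  Then [alpha (q_n + f q_{n-1}) = p_n + f p_{n-1}].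
    For [alpha = sqrt x], [p_n = y], [q_n = x] the unimodularity relation turns
    this into [|alpha x - y| = f / (x + f q_{n-1})]; multiplying by
    [y + alpha x = u x] gives [|k| = u / (1 / f + q_{n-1} / x)].  Finally
    [a <= 1 / f < a + 1] and [0 < q_{n-1} <= x]: [f = 0] would give [k = 0], and
    [q_{n-1} = 0] would give [x = 1], hence [f = |y - 1|], an integer strictly
    between 0 and 1. *)

Definition frac {R : realType} (t : R) : R := t - (Num.floor t)%:~R.

Lemma frac_ge0_lt1 (R : realType) (t : R) : 0 <= frac t < 1.
Proof.
by have := floor_itv t; rewrite /frac intrD => /andP[? ?]; apply/andP; split; lra.
Qed.

Lemma complete_quotient_step (R : realType) (alpha : R) (n : nat) :
  complete_quotient alpha n.+1 =
  obind (fun t => if frac t == 0 then None else Some (frac t)^-1)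
        (complete_quotient alpha n).
Proof. by rewrite /=; case: (complete_quotient alpha n). Qed.

(** The recursive definition advances at the last index. Peeling off the first quotient instead
    matches the right fold in [cf_value] and allows induction on [n] with [alpha] varying. *)
Lemma complete_quotientS (R : realType) (alpha : R) (n : nat) :
  frac alpha != 0 ->
  complete_quotient alpha n.+1 = complete_quotient (frac alpha)^-1 n.
Proof.
move=> f0; elim: n => [|n IHn]; first by rewrite complete_quotient_step /= (negPf f0).
by rewrite complete_quotient_step IHn -complete_quotient_step.
Qed.

Lemma complete_quotient_terminated (R : realType) (alpha : R) (n : nat) :
  frac alpha = 0 -> complete_quotient alpha n.+1 = None.
Proof.
move=> f0; elim: n => [|n IHn]; first by rewrite complete_quotient_step /= f0 eqxx.
by rewrite complete_quotient_step IHn.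
Qed.

Lemma convergentS (R : realType) (alpha : R) (n : nat) :
  frac alpha != 0 ->
  convergent alpha n.+1 =
  omap (fun r => (Num.floor alpha)%:~R + r^-1) (convergent (frac alpha)^-1 n).
Proof.
move=> f0.
have pqS m : partial_quotient alpha m.+1 = partial_quotient (frac alpha)^-1 m.
  by rewrite /partial_quotient complete_quotientS.
rewrite /convergent pqS; case: (partial_quotient _ n) => // a.
suff -> : pmap (partial_quotient alpha) (iota 0 n.+2) =
    Num.floor alpha :: pmap (partial_quotient (frac alpha)^-1) (iota 0 n.+1) by [].
have <- : pmap (partial_quotient alpha) (iota (1 + 0) n.+1) =
    pmap (partial_quotient (frac alpha)^-1) (iota 0 n.+1).
  by rewrite iotaDl; elim: (iota 0 n.+1) => //= m s ->; rewrite add1n pqS.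
by [].
Qed.

(* [p], [q], [p'], [q'] are p_n, q_n, p_{n-1}, q_{n-1}.  The bounds on [p], [p']
   are there because passing from [1 / frac alpha] to [alpha] turns numerators
   into denominators. *)
Lemma convergent_spec (R : realType) (n : nat) (alpha t : R) :
  1 <= alpha -> complete_quotient alpha n = Some t ->
  exists p q p' q' : int,
    [/\ convergent alpha n = Some (p%:~R / q%:~R),
        `|p * q' - p' * q| = 1,
        0 < p /\ 0 <= p' <= p,
        0 < q /\ 0 <= q' <= q &
        alpha * (q%:~R + frac t * q'%:~R) = p%:~R + frac t * p'%:~R].
Proof.
elim: n alpha => [|n IHn] alpha alpha_ge1.
  (* The conventional starting values p_{-1} = 1 and q_{-1} = 0. *)
  case=> <-; exists (Num.floor alpha), 1, 1, 0.
  have a_ge1 : 1 <= Num.floor alpha by rewrite floor_ge_int.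
  split; rewrite ?mulr0 ?invr1 ?mulr1 ?addr0 //.
  - by rewrite -[LHS]/(Some (_ + 0^-1)) invr0 addr0.
  - by rewrite /frac; ring.
have a_ge1 : 1 <= Num.floor alpha by rewrite floor_ge_int.
have [f0|f_neq0] := eqVneq (frac alpha) 0.
  by rewrite complete_quotient_terminated.
rewrite complete_quotientS // => /IHn[|p [q [p' [q' [cvE det [p_gt0 p'p] [q_gt0 q'q] E]]]]].
  have /andP[f_ge0 f_lt1] := frac_ge0_lt1 _ alpha.
  by rewrite invf_ge1 ?ltW // lt_def f_neq0.
set a := Num.floor alpha in a_ge1 *.
(* Prepending [a] sends a value [p / q] to [a + q / p = (a * p + q) / p]. *)
exists (a * p + q), p, (a * p' + q'), p'; split.
- rewrite convergentS // cvE /= invf_div intrD intrM mulrDl mulfK //.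
  by rewrite intr_eq0 gt_eqF.
- by rewrite -[RHS]det -normrN; congr `| _ |; ring.
- by nia.
- by [].
(* The induction hypothesis reads [b = frac alpha * c], so [alpha * c = a * c + b]. *)
- move: E; set b := q%:~R + _; set c := p%:~R + _ => /(canRL (mulVKf f_neq0)) bE.
  have -> : alpha = a%:~R + frac alpha by rewrite /frac /a; ring.
  by rewrite mulrDl -bE /b /c !intrD !intrM; ring.
Qed.

Lemma eq_lowest_terms (p q y x : int) :
  0 < q -> 0 < x -> coprimez p q -> coprimez y x ->
  p%:~R / q%:~R = y%:~R / x%:~R :> rat -> p = y /\ q = x.
Proof.
move=> q_gt0 x_gt0 cpq cyx E.
have qx : q = x.
  have := congr1 denq E.
  rewrite !coprimeq_den // !gt_eqF //; lia.
split=> //; move: E; rewrite qx => /(mulIf _) E; apply/(@intr_inj rat)/E.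
by rewrite invr_eq0 intr_eq0 gt_eqF.
Qed.

Lemma powR_3half (R : realType) (x : R) : 0 <= x -> x `^ (3 / 2) = Num.sqrt x * x.
Proof.
move=> x_ge0; have -> : 3 / 2 = 2^-1 + 1 :> R by lra.
by rewrite powRD ?powRr1 ?powR12_sqrt //; apply/implyP => /eqP; lra.
Qed.

Theorem proposition5p2 (R : realType) (x y k : int) (n : nat)
    (hsol : primitive_solution x y k)
    (hconv : convergent (Num.sqrt (x%:~R : R)) n = Some (y%:~R / x%:~R)) :
  exists a : int,
    partial_quotient (Num.sqrt (x%:~R : R)) n.+1 = Some a /\
    let u : R := (y%:~R + x%:~R `^ (3 / 2)) / x%:~R in
    u / (a%:~R + 2) < `|k|%:~R < u / a%:~R.
Proof.
case: hsol => -[curve x_ge1 y_ge1 k_neq0] gcd1.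
have XR_ge1 : 1 <= x%:~R :> R by rewrite ler1z.
have YR_ge1 : 1 <= y%:~R :> R by rewrite ler1z.
set alpha := Num.sqrt (x%:~R : R) in hconv *.
have alpha_ge1 : 1 <= alpha by rewrite -sqrtr1 ler_wsqrtr.
have alpha2 : alpha ^+ 2 = x%:~R by rewrite sqr_sqrtr //; lra.
case cqn: (complete_quotient alpha n) => [t|]; last first.
  by move: hconv; rewrite /convergent /partial_quotient cqn.
have [p [q [p' [q' [cvE det _ [q_gt0 /andP[q'_ge0 q'_le]] E]]]]] :=
  convergent_spec _ _ _ _ alpha_ge1 cqn.
have [] : p = y /\ q = x.
  apply: eq_lowest_terms => //; try lia.
  (* Up to sign, the determinant relation is a Bezout identity for [p] and [q]. *)
  - apply/coprimezP; have [d|d] : p * q' - p' * q = 1 \/ p * q' - p' * q = -1 by lia.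
    + by exists (q', - p') => /=; lia.
    + by exists (- q', p') => /=; lia.
  - by rewrite coprimez_sym /coprimez gcd1.
  - by move: hconv; rewrite cvE => -[].
move=> ? ?; subst p q.
have kE : k%:~R = (y%:~R - alpha * x%:~R) * (y%:~R + alpha * x%:~R) :> R.
  have -> : k = y ^+ 2 - x ^+ 3 by rewrite curve; ring.
  by rewrite intrB !rmorphXn /= -subr_sqr exprMn alpha2; ring.
have /andP[f_ge0 f_lt1] := frac_ge0_lt1 _ t.
set f := frac t in E f_ge0 f_lt1.
have q'R_ge0 : 0 <= q'%:~R :> R by rewrite ler0z.
have den_gt0 : 0 < x%:~R + f * q'%:~R :> R.
  by have := mulr_ge0 f_ge0 q'R_ge0; lra.
have dist : `|y%:~R - alpha * x%:~R| * (x%:~R + f * q'%:~R) = f.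
  rewrite -[X in _ * X](gtr0_norm den_gt0) -normrM.
  (* By [E] the product is [y * (x + f * q') - x * (y + f * p')], where [x * y] cancels and [f]
     times the determinant remains. *)
  have -> : (y%:~R - alpha * x%:~R) * (x%:~R + f * q'%:~R) =
            f * (y * q' - p' * x)%:~R.
    have -> : (y%:~R - alpha * x%:~R) * (x%:~R + f * q'%:~R) =
      y%:~R * (x%:~R + f * q'%:~R) - x%:~R * (alpha * (x%:~R + f * q'%:~R)) by ring.
    by rewrite E intrB !intrM; ring.
  by rewrite normrM -intr_norm det mulr1 ger0_norm.
have f_gt0 : 0 < f.
  rewrite lt_def f_ge0 andbT; apply/eqP => f0; case/eqP: k_neq0.
  apply/(@intr_inj R); rewrite kE.
  move/eqP: dist; rewrite {2}f0 mulf_eq0 normr_eq0 (gt_eqF den_gt0) orbF.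
  by move/eqP ->; rewrite mul0r.
(* The strict upper bound rests on this, since [a <= f^-1] may be an equality. *)
have q'_gt0 : 0 < q'.
  rewrite lt_def q'_ge0 andbT; apply/eqP => q'0.
  have x1 : x = 1.
    move: det; rewrite q'0 mulr0 sub0r normrN normrM (gtr0_norm q_gt0).
    move=> p'x; suff : (x %| 1)%Z by rewrite dvdz1; lia.
    by apply/dvdzP; exists `|p'|; rewrite p'x.
  move: dist; rewrite q'0 /alpha x1 sqrtr1 mulr0 addr0 !mulr1.
  rewrite -(intrB _ _ 1) -intr_norm => dist.
  by move: f_gt0 f_lt1; rewrite -dist ltr0z ltrz1; lia.
have fK : frac t != 0 by rewrite gt_eqF.
exists (Num.floor f^-1); split.
  by rewrite /partial_quotient /= cqn -/(frac t) (negPf fK).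
have a_ge1 : 1 <= (Num.floor f^-1)%:~R :> R.
  by rewrite ler1z floor_ge_int invf_ge1 // ltW.
have := floor_itv f^-1; rewrite intrD => /andP[].
set a := (Num.floor f^-1)%:~R in a_ge1 * => a_le a_gt.
rewrite powR_3half; last lra.
rewrite -/alpha /=; set u := (y%:~R + _) / _.
have u_gt0 : 0 < u.
  have alphax_gt0 : 0 < alpha * x%:~R by apply: mulr_gt0; lra.
  by apply: divr_gt0; lra.
have normk : `|k|%:~R = u / (f^-1 + q'%:~R / x%:~R) :> R.
  have fR : f != 0 by [].
  have XR_neq0 : x%:~R != 0 :> R by rewrite gt_eqF //; lra.
  have -> : f^-1 + q'%:~R / x%:~R = (x%:~R + f * q'%:~R) / (f * x%:~R) :> R.
    by field; apply/andP.
  have ux : y%:~R + alpha * x%:~R = u * x%:~R by rewrite divfK.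
  rewrite intr_norm kE normrM ux [`|u * _|]gtr0_norm; last by rewrite mulr_gt0 //; lra.
  apply: (mulIf (lt0r_neq0 den_gt0)).
  rewrite mulrAC dist; field.
  by rewrite XR_neq0 fR lt0r_neq0.
have ratio_gt0 : 0 < q'%:~R / x%:~R :> R by rewrite divr_gt0 ?ltr0z.
have ratio_le1 : q'%:~R / x%:~R <= 1 :> R.
  by rewrite ler_pdivrMr ?ltr0z // mul1r ler_int.
(* With [u > 0], both bounds reduce to [a < f^-1 + q' / x < a + 2]. *)
by rewrite normk; apply/andP; split; rewrite ltr_pM2l // ltf_pV2 ?posrE; lra.
Qed.
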